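(* Let $\mathbf{Q}[x]^{\mathsf{subs}}$ be the algebra with universe $\mathbb{Q}[x]$ and operations addition, multiplication and composition $(p,q)\mapsto p[x:=q]$. (1) The equivalence problem for deterministic bottom-up register automata with values in $\mathbf{Q}[x]^{\mathsf{subs}}$ (given two such automata over the same input signature, decide whether they define the same partial function) is undecidable, even when restricted to automata with a monadic input alphabet. (2) The functionality problem for bottom-up register automata with values in $\mathbf{Q}[x]^{\mathsf{subs}}$ (given such an automaton, decide whether it is functional) is undecidable, even when restricted to automata with a one-letter monadic input alphabet.
   Context: Alphabets. A ranked signature $\Sigma$ is a finite set of symbols, each with a finite rank; ranked trees are terms over $\Sigma$. A monadic alphabet is a ranked signature consisting of one symbol $\bot$ of rank $0$ and finitely many symbols of rank $1$ (so input trees are essentially words over the rank-$1$ symbols); it is one-letter if there is exactly one symbol $a$ of rank $1$, i.e. the signature is $\{a,\bot\}$. Polynomial functions. For an algebra with universe $A$, a polynomial function $A^k\to A$ is a function induced by a term built from variables, elements of $A$ as constants, and the operations of the algebra (here $+$, $\times$ and composition); a polynomial function $A^k\to A^m$ is an $m$-tuple of such functions. Register automata. A bottom-up register automaton with values in an algebra with universe $A$ is a tuple $M=(\Sigma,n,Q,\delta,F)$ where $\Sigma$ is a ranked signature, $n$ is the number of registers, $Q$ is a finite set of states, $\delta$ is a finite set of rules $a(q_1,\dots,q_k)\to q,f$ with $a\in\Sigma$ of rank $k$, $q,q_1,\dots,q_k\in Q$, and $f:A^{n\times k}\to A^n$ a polynomial function, and $F$ is a partial function associating to some states $q$ a polynomial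 function $f_q:A^n\to A$. Inductively, $a(t_1,\dots,t_k)\to(q,f(\bar r_1,\dots,\bar r_k))$ whenever $a(q_1,\dots,q_k)\to q,f$ is in $\delta$ and $t_i\to(q_i,\bar r_i)$ for all $i$. The relation $[\![M]\!]$ relates a tree $t$ to each value $f_q(\bar r)$ such that $t\to(q,\bar r)$ and $F(q)=f_q$ is defined. $M$ is functional if $[\![M]\!]$ is a (partial) function. $M$ is deterministic if for all $a,q_1,\dots,q_k$ there is at most one rule in $\delta$ with left-hand side $a(q_1,\dots,q_k)$. *)

(* Defs.v *)
From Stdlib Require List.
From HB Require Import structures.
From mathcomp Require Import all_boot all_order all_algebra.

Set Implicit Arguments.
Unset Strict Implicit.
Unset Printing Implicit Defensive.

Inductive recfun : nat -> Type :=
| RZero k : recfun k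
| RSucc : recfun 1
| RProj k (i : 'I_k) : recfun k
| RComp k m (f : recfun m) (g : 'I_m -> recfun k) : recfun k
| RPrec k (f : recfun k) (g : recfun k.+2) : recfun k.+1
| RMu k (f : recfun k.+1) : recfun k.

(* [graph f v y]: the partial recursive function f is defined at v, with
   value y.  In the case of primitive recursion, s lists the intermediate
   values; in the case of minimisation, f must be defined and nonzero at
   every candidate below y. *)
Fixpoint graph k (f : recfun k) : k.-tuple nat -> nat -> Prop :=
  match f in recfun k return k.-tuple nat -> nat -> Prop with
  | RZero _ => fun _ y => y = 0
  | RSucc => fun v y => y = (thead v).+1
  | RProj _ i => fun v y => y = tnth v i
  | RComp _ m f g => fun v y =>
      exists w : m.-tuple nat,
        (forall i, graph (g i) v (tnth w i)) /\ graph f w y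
  | RPrec k f g => fun v y =>
      let x : k.-tuple nat := [tuple of behead v] in
      exists s : nat -> nat,
        [/\ graph f x (s 0),
            forall i, i < thead v ->
              graph g [tuple of i :: s i :: x] (s i.+1)
          & y = s (thead v)]
  | RMu _ f => fun v y =>
      graph f [tuple of y :: v] 0 /\
      forall i, i < y -> exists z, graph f [tuple of i :: v] z.+1
  end.

(* The problem "given x in X satisfying D, decide whether P x".  Nothing is
   required of the deciding function f on numbers that are not codes of
   elements of D, so that undecidability is asserted in its strongest form. *)
Definition decidable_on (X : Type) (code : X -> nat) (D P : X -> Prop) : Prop :=
  exists f : recfun 1, forall x : X, D x ->
    (P x -> graph f [tuple code x] 1) /\ (~ P x -> graph f [tuple code x] 0).

(* A ranked signature is given by the list of the ranks of its symbols; the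
   symbols themselves are the positions in this list. *)
Definition signature := seq nat.
Definition symbol (S : signature) := 'I_(size S).
Definition rank (S : signature) (a : symbol S) : nat := nth 0 S a.

Inductive tree (S : signature) : Type :=
| Node (a : symbol S) (ts : {ffun 'I_(rank a) -> tree S}).

Definition monadic (S : signature) : bool :=
  (count_mem 0 S == 1) && all (fun k => k <= 1) S.

Definition one_letter (S : signature) : bool :=
  monadic S && (count_mem 1 S == 1).

(* TComp t u stands for t[x := u]: the substitution is for the indeterminate
   x of Q[x], not for a variable of the term. *)
Inductive term (V : Type) : Type :=
| TVar (v : V)
| TConst (p : {poly rat})
| TAdd (t u : term V)
| TMul (t u : term V)
| TComp (t u : term V).

Fixpoint eval (V : Type) (e : V -> {poly rat}) (t : term V) : {poly rat} :=
  match t with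
  | TVar v => e v
  | TConst p => p
  | TAdd t u => (eval e t + eval e u)%R
  | TMul t u => (eval e t * eval e u)%R
  | TComp t u => (eval e t \Po eval e u)%R
  end.

(* n registers, m states; the variable (j, i) of an update stands for
   register j of the i-th subtree. *)
Record rule (S : signature) (n m : nat) := Rule {
  rsym : symbol S;
  rsrc : {ffun 'I_(rank rsym) -> 'I_m};
  rtgt : 'I_m;
  rupd : {ffun 'I_n -> term ('I_n * 'I_(rank rsym))}
}.

Definition lhs (S : signature) (n m : nat) (r : rule S n m) :
    {a : symbol S & {ffun 'I_(rank a) -> 'I_m}} :=
  existT _ (rsym r) (rsrc r).

(* The polynomial functions of an automaton are presented by terms, and the
   finite set of rules by a list. *)
Record automaton (S : signature) := Automaton {
  nreg : nat;
  nstate : nat;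
  rules : seq (rule S nreg nstate);
  final : {ffun 'I_nstate -> option (term 'I_nreg)}
}.

Inductive reach (S : signature) (M : automaton S) :
    tree S -> 'I_(nstate M) -> {ffun 'I_(nreg M) -> {poly rat}} -> Prop :=
| Reach (r : rule S (nreg M) (nstate M))
    (ts : {ffun 'I_(rank (rsym r)) -> tree S})
    (v : 'I_(rank (rsym r)) -> {ffun 'I_(nreg M) -> {poly rat}}) :
    List.In r (rules M) ->
    (forall i, reach (ts i) (rsrc r i) (v i)) ->
    reach (Node ts) (rtgt r)
      [ffun j => eval (fun x => v x.2 x.1) (rupd r j)].

Definition relates (S : signature) (M : automaton S)
    (t : tree S) (p : {poly rat}) : Prop :=
  exists q v f, [/\ reach t q v, final M q = Some f & p = eval v f].

Definition functional (S : signature) (M : automaton S) : Prop :=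
  forall t p1 p2, relates M t p1 -> relates M t p2 -> p1 = p2.

Definition deterministic (S : signature) (M : automaton S) : Prop :=
  forall r1 r2, List.In r1 (rules M) -> List.In r2 (rules M) ->
    lhs r1 = lhs r2 -> r1 = r2.

Definition equivalent (S : signature) (M1 M2 : automaton S) : Prop :=
  forall t p, relates M1 t p <-> relates M2 t p.

Definition aut_instance := {S : signature & automaton S}.
Definition pair_instance := {S : signature & (automaton S * automaton S)%type}.

(* [CodeSeq.code] is the bijection from seq nat to nat sending the empty list
   to 0 and n :: s to 2 ^ n * (2 * code s + 1). *)
Notation code_seq := CodeSeq.code.

Definition code_fun (n : nat) (X : Type) (c : X -> nat) (f : 'I_n -> X) : nat :=
  code_seq [seq c (f i) | i <- enum 'I_n].

Definition code_int (z : int) : nat :=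
  match z with Posz n => n.*2 | Negz n => n.*2.+1 end.

Definition code_rat (q : rat) : nat :=
  code_seq [:: code_int (numq q); code_int (denq q)].

Definition code_poly (p : {poly rat}) : nat :=
  code_seq [seq code_rat a | a <- polyseq p].

Fixpoint code_term (V : Type) (c : V -> nat) (t : term V) : nat :=
  match t with
  | TVar v => code_seq [:: 0; c v]
  | TConst p => code_seq [:: 1; code_poly p]
  | TAdd t u => code_seq [:: 2; code_term c t; code_term c u]
  | TMul t u => code_seq [:: 3; code_term c t; code_term c u]
  | TComp t u => code_seq [:: 4; code_term c t; code_term c u]
  end.

Definition code_upd_var (n k : nat) (x : 'I_n * 'I_k) : nat :=
  code_seq [:: nat_of_ord x.1; nat_of_ord x.2].

Definition code_rule (S : signature) (n m : nat) (r : rule S n m) : nat :=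
  code_seq [:: nat_of_ord (rsym r);
               code_fun (@nat_of_ord m) (rsrc r);
               nat_of_ord (rtgt r);
               code_fun (code_term (@code_upd_var n (rank (rsym r)))) (rupd r)].

Definition code_final (n : nat) (o : option (term 'I_n)) : nat :=
  if o is Some t then (code_term (@nat_of_ord n) t).+1 else 0.

Definition code_automaton (S : signature) (M : automaton S) : nat :=
  code_seq [:: nreg M; nstate M;
               code_seq [seq code_rule r | r <- rules M];
               code_fun (@code_final (nreg M)) (final M)].

Definition code_aut (I : aut_instance) : nat :=
  code_seq [:: code_seq (tag I); code_automaton (tagged I)].

Definition code_pair (I : pair_instance) : nat :=
  code_seq [:: code_seq (tag I);
               code_automaton (tagged I).1; code_automaton (tagged I).2].

Lemma code_seq_inj : injective code_seq.
Proof. exact: can_inj CodeSeq.codeK. Qed.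

Lemma code_fun_inj n X (c : X -> nat) (f g : 'I_n -> X) :
  injective c -> code_fun c f = code_fun c g -> f =1 g.
Proof.
move=> c_inj /code_seq_inj/eq_in_map fg i.
by apply/c_inj/fg; rewrite mem_enum.
Qed.

Lemma code_int_inj : injective code_int.
Proof.
have h m n : m.*2 <> n.*2.+1 by move/(congr1 odd); rewrite /= !odd_double.
case=> m [] n /= e; [| by case: (h _ _ e) | by case: (h _ _ (esym e)) |].
- by rewrite (double_inj e).
- by case: e => /double_inj ->.
Qed.

Lemma code_rat_inj : injective code_rat.
Proof.
move=> p q /code_seq_inj[/code_int_inj en /code_int_inj ed].
by rewrite -(divq_num_den p) en ed divq_num_den.
Qed.

Lemma code_poly_inj : injective code_poly.
Proof.
by move=> p q /code_seq_inj/(inj_map code_rat_inj) e; apply: val_inj.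
Qed.

Lemma code_term_inj V (c : V -> nat) : injective c -> injective (code_term c).
Proof.
move=> c_inj; elim=> [v|p|t IHt u IHu|t IHt u IHu|t IHt u IHu];
  case=> [v'|p'|t' u'|t' u'|t' u'] /code_seq_inj // [].
- by move/c_inj=> ->.
- by move/code_poly_inj=> ->.
all: by move=> /IHt -> /IHu ->.
Qed.

Lemma code_rule_inj S n m : injective (@code_rule S n m).
Proof.
move=> [a s q u] [a' s' q' u'] /code_seq_inj[] /= /ord_inj ea.
move: s' u'; rewrite -{}ea => s' u' es /ord_inj -> eu.
have -> : s = s' by apply/ffunP; apply: code_fun_inj es; apply: ord_inj.
suff -> : u = u' by [].
apply/ffunP; apply: code_fun_inj eu; apply: code_term_inj => -[i j] [k l].
by case/code_seq_inj => /= /ord_inj -> /ord_inj ->.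
Qed.

Lemma code_final_inj n : injective (@code_final n).
Proof.
by move=> [t|] [u|] //= [] /(code_term_inj (@ord_inj n)) ->.
Qed.

Lemma code_automaton_inj S : injective (@code_automaton S).
Proof.
move=> [n m d f] [n' m' d' f'] /code_seq_inj[] /= en em.
move: d' f'; rewrite -{}en -{}em => d' f'.
move=> /code_seq_inj/(inj_map (@code_rule_inj S n m)) -> ef.
suff -> : f = f' by [].
by apply/ffunP; apply: code_fun_inj ef; apply: code_final_inj.
Qed.

Lemma code_aut_inj : injective code_aut.
Proof.
move=> [S M] [S' M'] /code_seq_inj[/code_seq_inj /= eS].
by move: M'; rewrite -{}eS => M' /code_automaton_inj ->.
Qed.

Lemma code_pair_inj : injective code_pair.
Proof.
move=> [S [M N]] [S' [M' N']] /code_seq_inj[/code_seq_inj /= eS].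
move: M' N'; rewrite -{}eS => M' N'.
by move=> /code_automaton_inj -> /code_automaton_inj ->.
Qed.

Definition deterministic_pair (I : pair_instance) : Prop :=
  deterministic (tagged I).1 /\ deterministic (tagged I).2.

Definition equivalent_pair (I : pair_instance) : Prop :=
  equivalent (tagged I).1 (tagged I).2.

Definition equivalence_decidable (Sigma_ok : signature -> bool) : Prop :=
  decidable_on code_pair
    (fun I => Sigma_ok (tag I) /\ deterministic_pair I) equivalent_pair.

Definition functionality_decidable (Sigma_ok : signature -> bool) : Prop :=
  decidable_on code_aut
    (fun I => Sigma_ok (tag I)) (fun I => functional (tagged I)).

(* Main.v *)
(* Let h be a partial recursive function.  It is compiled to a program over
   registers with values in N, whose actions are increment, reset, copy and
   (dis)equality tests, and then to a finite automaton whose edges carry these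
   actions.  A register automaton over Q[x] simulates a sequence of edges by
   keeping the register values as constants, together with the polynomial
   F_n = (x - 1) ... (x - n), where n bounds all register values: after each step
   F_n is replaced by (x - 1) * F_n[x := x - 1] = F_(n + 1).  For integers a, b
   between 0 and n, F_n(a - b) * F_n(b - a) is nonzero exactly when a = b, so that
   both tests amount to the nonvanishing of a polynomial expression.  A flag
   multiplies all these expressions, and is nonzero at the final state exactly
   when the sequence of edges is a halting computation.  The automaton whose flag
   is initially 0 has the same runs but only outputs 0; so h halts if and only if
   the two automata are not equivalent, and, taking both initial rules in one
   automaton, if and only if this automaton is not functional.

   Given a function f that would decide one of the problems, take h = f o C,
   where C maps certain numerical parameters (among them the code of the list of
   edge rules) to the code of an instance in which these parameters are also the
   inputs of the simulated program.  On the parameters of its own instance, h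
   computes the answer of f on that instance, which is therefore wrong. *)
From Stdlib Require List.
Require Import Defs.
From mathcomp Require Import all_boot all_order all_algebra.
From mathcomp Require Import zify.
Set Implicit Arguments.
Unset Strict Implicit.
Unset Printing Implicit Defensive.
Import GRing.Theory Num.Theory.

(** * Partial recursive functions *)

Lemma graph_inj k (f : recfun k) v y z : graph f v y -> graph f v z -> y = z.
Proof.
elim: k / f v y z => [k|| k i|k m f IHf g IHg|k f IHf g IHg|k f IHf] v y z /=;
  try by move=> -> ->.
- move=> [w [gw fw]] [w' [gw' fw']].
  have ew : w = w' by apply: eq_from_tnth => i; apply: IHg (gw i) (gw' i).
  by rewrite -ew in fw'; apply: IHf fw fw'.
- move=> [s [s0 sS ->]] [s' [s'0 s'S ->]].
  suff h i : i <= thead v -> s i = s' i by apply: h.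
  elim: i => [_|i IHi lt_iv]; first exact: IHf s0 s'0.
  apply: IHg (sS _ lt_iv) _; rewrite (IHi (ltnW lt_iv)); exact: s'S.
(* Of two distinct results, the smaller would be a point where [f] is both zero and positive. *)
- move=> [fy0 fyS] [fz0 fzS]; case: (ltngtP y z) => // lt.
  + by have [u fu] := fzS _ lt; have := IHf _ _ _ fy0 fu.
  + by have [u fu] := fyS _ lt; have := IHf _ _ _ fz0 fu.
Qed.

Definition computable k (F : k.-tuple nat -> nat) : Prop :=
  exists r : recfun k, forall v, graph r v (F v).

Lemma computable_const k n : computable (fun _ : k.-tuple nat => n).
Proof.
elim: n => [|n [r rP]]; first by exists (RZero k).
exists (RComp RSucc (fun _ : 'I_1 => r)) => v.
by exists [tuple n]; split=> // i; rewrite ord1.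
Qed.

Lemma computable_proj k (i : 'I_k) : computable (fun v => tnth v i).
Proof. by exists (RProj i). Qed.

Lemma computable_comp k m (F : m.-tuple nat -> nat)
    (G : 'I_m -> k.-tuple nat -> nat) :
  computable F -> (forall i, computable (G i)) ->
  computable (fun v => F [tuple G i v | i < m]).
Proof.
move=> [f fP] /(@fin_all_exists _ (fun=> recfun k)) [g gP].
exists (RComp f g) => v; exists [tuple G i v | i < m]; split=> // i.
by rewrite tnth_mktuple.
Qed.

Definition computable1 (g : nat -> nat) : Prop :=
  computable (fun v : 1.-tuple nat => g (thead v)).

Lemma computable_comp1 k g (F : k.-tuple nat -> nat) :
  computable1 g -> computable F -> computable (fun v => g (F v)).
Proof.
move=> cg cF; have [r rP] := computable_comp cg (fun _ : 'I_1 => cF).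
by exists r => v; have := rP v; rewrite /thead tnth_mktuple.
Qed.

Lemma computable_iter k g (N B : k.-tuple nat -> nat) :
  computable1 g -> computable N -> computable B ->
  computable (fun v => iter (N v) g (B v)).
Proof.
move=> [r rP] cN cB.
have cI : computable (fun v : 2.-tuple nat =>
    iter (tnth v ord0) g (tnth v (lift ord0 ord0))).
  exists (RPrec (RProj ord0) (RComp r (fun _ => RProj (lift ord0 ord0)))) => v.
  exists (fun n => iter n g (tnth v (lift ord0 ord0))).
  case/tupleP: v => a v; case/tupleP: v => b v; split=> [|i _|] /=.
  - by rewrite !(tnth_nth 0).
  - set y := iter i g _; exists [tuple y]; split; last exact: rP.
    by move=> j; rewrite ord1 !(tnth_nth 0).
  - by rewrite /thead !(tnth_nth 0).
pose G (i : 'I_2) := if i == ord0 then N else B.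
have cG i : computable (G i) by rewrite /G; case: ifP.
have [s sP] := computable_comp cI cG.
by exists s => v; have := sP v; rewrite !tnth_mktuple.
Qed.

(** The cons step of [code_seq]: [code_seq (a :: l)] is [npair a (code_seq l)]. *)
Definition npair (a b : nat) : nat := 2 ^ a * b.*2.+1.

Lemma computable_npair k (A B : k.-tuple nat -> nat) :
  computable A -> computable B -> computable (fun v => npair (A v) (B v)).
Proof.
have cS : computable1 S by exists RSucc.
have cD : computable1 double.
  have cSS : computable1 (fun n => n.+2) by apply: (computable_comp1 cS cS).
  have [r rP] := computable_iter cSS (computable_proj (@ord0 0))
    (computable_const 1 0).
  exists r => v; have := rP v; rewrite -/(thead v).
  by congr (graph r v _); elim: (thead v) => //= n ->.
move=> cA cB.
have [r rP] := computable_iter cD cA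
  (computable_comp1 cS (computable_comp1 cD cB)).
exists r => v; have := rP v; congr (graph r v _).
rewrite /npair; elim: (A v) => [|n IH] /=; first by rewrite mul1n.
by rewrite IH expnS -mul2n mulnA.
Qed.

(** The list is fixed in advance, so the fold is a finite composition of computable functions. *)
Lemma computable_foldr k (I : Type) (F : I -> k.-tuple nat -> nat -> nat)
    (B : k.-tuple nat -> nat) (s : seq I) :
  (forall i C, computable C -> computable (fun v => F i v (C v))) ->
  computable B -> computable (fun v => foldr (fun i => F i v) (B v) s).
Proof. by move=> cF cB; elim: s => //= i s; apply: cF. Qed.

(** * Register programs *)

Inductive act :=
| Test (b : bool) (i j : nat)
| Inc (i : nat)
| Reset (i : nat)
| Copy (i j : nat).

(** A test of a register against itself always passes and changes nothing. *)
Definition skip := Test true 0 0.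

Definition regs := nat -> nat.

Definition set_reg (s : regs) i x : regs := fun j => if j == i then x else s j.

Definition guard (a : act) (s : regs) : bool :=
  if a is Test b i j then (s i == s j) == b else true.

Definition update (a : act) (s : regs) : regs :=
  match a with
  | Test _ _ _ => s
  | Inc i => set_reg s i (s i).+1
  | Reset i => set_reg s i 0
  | Copy i j => set_reg s i (s j)
  end.

(** [Star c] may stop after any number of rounds; the tests placed in and after a loop block the
    executions that leave it at the wrong moment. *)
Inductive cmd :=
| Act (a : act)
| Seq (c d : cmd)
| Star (c : cmd).

Inductive star (R : regs -> regs -> Prop) (s : regs) : regs -> Prop :=
| star_refl : star R s s
| star_snoc t u : star R s t -> R t u -> star R s u.

Fixpoint exec (c : cmd) : regs -> regs -> Prop :=
  match c with
  | Act a => fun s t => guard a s /\ t = update a s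
  | Seq c d => fun s u => exists2 t, exec c s t & exec d t u
  | Star c => star (exec c)
  end.

Notation "c ;; d" := (Seq c d) (at level 61, right associativity).

(* Writes the result to register out, using the registers from b on as
   scratch space.  Since out is written last, it may be one of the arguments. *)
Fixpoint compile k (f : recfun k) : k.-tuple nat -> nat -> nat -> cmd :=
  match f in recfun k return k.-tuple nat -> nat -> nat -> cmd with
  | RZero _ => fun _ out _ => Act (Reset out)
  | RSucc => fun args out _ => Act (Copy out (thead args)) ;; Act (Inc out)
  | RProj _ i => fun args out _ => Act (Copy out (tnth args i))
  | RComp _ m f g => fun args out b =>
      foldr (fun i c => compile (g i) args (b + i) (b + m) ;; c)
        (compile f [tuple b + i | i < m] out (b + m)) (enum 'I_m)
  | RPrec k f g => fun args out b =>
      let x : k.-tuple nat := [tuple of behead args] in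
      compile f x b b.+2 ;; Act (Reset b.+1) ;;
      Star (Act (Test false b.+1 (thead args)) ;;
            compile g [tuple of b.+1 :: b :: x] b b.+2 ;; Act (Inc b.+1)) ;;
      Act (Test true b.+1 (thead args)) ;; Act (Copy out b)
  | RMu k f => fun args out b =>
      let c := compile f [tuple of b :: args] b.+1 b.+3 in
      Act (Reset b) ;; Act (Reset b.+2) ;;
      Star (c ;; Act (Test false b.+1 b.+2) ;; Act (Inc b)) ;;
      c ;; Act (Test true b.+1 b.+2) ;; Act (Copy out b)
  end.

(** * Correctness of the compiled programs *)

Definition agree (b out : nat) (s t : regs) : Prop :=
  forall r, r < b -> r != out -> t r = s r.

Definition values k (s : regs) (args : k.-tuple nat) : k.-tuple nat :=
  map_tuple s args.


(** All terminating executions are covered, whatever the choices made in their loops. The frame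
    condition [agree] is part of the induction, since arguments and pending intermediate values must
    survive the inner calls. *)
Lemma compile_sound k (f : recfun k) (args : k.-tuple nat) out b s t :
  all (gtn b) args -> exec (compile f args out b) s t ->
  graph f (values s args) (t out) /\ agree b out s t.
Proof.
elim: k / f args out b s t
  => [k|| k i|k m f IHf g IHg|k f IHf g IHg|k f IHf] args out b s t args_b.
- by move=> [_ ->] /=; rewrite /set_reg eqxx; split=> // r _ /negPf ->.
- move=> /= [u [_ ->] [_ ->]]; rewrite /= /set_reg !eqxx; split.
    by rewrite /thead tnth_map.
  by move=> r _ /negPf ->.
- move=> [_ ->] /=; rewrite /set_reg eqxx tnth_map; split=> // r _ /negPf ->.
  by [].
- move=> /= ex.
  have [w [gw agr fw]] : exists w,
      [/\ forall i, graph (g i) (values s args) (w (b + i)),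
          forall r, r < b -> w r = s r
        & exec (compile f [tuple b + i | i < m] out (b + m)) w t].
    have: uniq (enum 'I_m) := enum_uniq _.
    have: forall i, i \in enum 'I_m by move=> i; rewrite mem_enum.
    (* Generalised to the list [l] of calls still to be made; the result registers of the other
       calls keep their contents. *)
    suff: forall l, uniq l -> forall s',
      exec (foldr (fun i c => compile (g i) args (b + i) (b + m) ;; c)
        (compile f [tuple b + i | i < m] out (b + m)) l) s' t ->
      (forall r, r < b -> s' r = s r) ->
      exists w, [/\ forall i : 'I_m, if i \in l
              then graph (g i) (values s args) (w (b + i))
              else w (b + i) = s' (b + i),
          forall r, r < b -> w r = s r
        & exec (compile f [tuple b + i | i < m] out (b + m)) w t].
      move=> h enP un; have [//|w [gw agr fw]] := h _ un _ ex.
      by exists w; split=> // i; have := gw i; rewrite enP.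
    elim=> [_ s' ? ?|i l IHl /= /andP[il ul] s' [s1 e1 e2] agr]; first by exists s'.
    have args_bm : all (gtn (b + m)) args.
      by apply: (sub_all _ args_b) => r /= rb; rewrite ltn_addr.
    have [gi agr1] := IHg _ _ _ _ _ _ args_bm e1.
    have agr' r : r < b -> s1 r = s r.
      by move=> rb; rewrite agr1 ?agr// ?ltn_addr//; lia.
    have [w [gw agrw fw]] := IHl ul _ e2 agr'.
    exists w; split=> // j; have := gw j; rewrite inE.
    case: (eqVneq j i) => [->|ji] /=.
      rewrite (negPf il) => ->; congr (graph _ _ _): gi.
      apply: val_inj; apply/eq_in_map => r /(allP args_b) /= rb; exact: agr.
    case: ifP => // _ ->; apply: agr1; first by rewrite ltn_add2l.
    by rewrite eqn_add2l.
  have bm : all (gtn (b + m)) [tuple b + i | i < m].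
    by apply/allP=> r /mapP[i _ ->] /=; rewrite ltn_add2l.
  have [fo agrt] := IHf _ _ _ _ _ bm fw.
  split; last by move=> r rb ro; rewrite agrt ?agr// ltn_addr.
  exists (values w [tuple b + i | i < m]); split=> // i.
  by rewrite tnth_map tnth_mktuple.
- move=> /= [s1 e1 [s2 [_ ->]]] [s3 e3 [s4 [/= /eqP/eqP eqn ->] [_ ->]]] /=.
  set x := [tuple of behead args] in e1 e3 *.
  have [n_b xb] : thead args < b /\ all (gtn b) x.
    by rewrite /x; case/tupleP: (args) args_b => a v /= /andP[].
  have x_b : all (gtn b.+2) x by apply: (sub_all _ xb) => r /=; lia.
  have [f1 agr1] := IHf _ _ _ _ _ x_b e1.
  have vx : [tuple of behead (values s args)] = values s x.
    by apply: val_inj; rewrite /= behead_map.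
  have vn : thead (values s args) = s (thead args) by rewrite /thead tnth_map.
  (* Loop invariant: register [b.+1] counts the rounds, register [b] is the accumulator, and [sq]
     records the successive accumulator values. *)
  have [agr [sq [q0 qS qc]]] : (forall r, r < b -> s3 r = s r) /\ exists sq : nat -> nat,
     [/\ graph f (values s x) (sq 0), forall i, i < s3 b.+1 ->
              graph g [tuple of i :: sq i :: values s x] (sq i.+1)
          & s3 b = sq (s3 b.+1)].
    elim: e3 => [|u w _ [agr [sq [q0 qS qc]]] [u1 [/= /eqP neq ->] [u2 e2 [_ ->]]]].
      split; first by move=> r rb; rewrite /set_reg ltn_eqF ?agr1//; lia.
      by exists (fun=> s1 b); split=> [//|i|]; rewrite /= /set_reg ?eqxx ?ltn_eqF.
    have cx : all (gtn b.+2) (b.+1 :: b :: x) by rewrite /= x_b; lia.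
    have [g2 agr2] := IHg _ _ _ _ _ cx e2.
    have ec : u2 b.+1 = u b.+1 by apply: agr2; lia.
    have eb : forall r, r < b -> u2 r = u r by move=> r rb; apply: agr2; lia.
    split; first by move=> r rb; rewrite /= /set_reg ltn_eqF ?eb ?agr//; lia.
    exists (fun i => if i <= u b.+1 then sq i else u2 b).
    have -> : set_reg u2 b.+1 (u2 b.+1).+1 b.+1 = (u b.+1).+1.
      by rewrite /= /set_reg eqxx ec.
    have -> : set_reg u2 b.+1 (u2 b.+1).+1 b = u2 b by rewrite /= /set_reg ltn_eqF.
    rewrite ltnn; split=> // i.
    rewrite ltnS; case: ltngtP => // [iu _|-> _]; first exact: qS.
    congr (graph _ _ _): g2; apply: val_inj => /=; rewrite qc.
    by congr [:: _, _ & _]; apply/eq_in_map => r /(allP xb) /=; apply: agr.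
  split; last by move=> r rb ro; rewrite /set_reg (negPf ro) agr.
  exists sq; rewrite /set_reg eqxx vn -(agr _ n_b) -eqn; split=> //.
    by rewrite vx.
  by move=> i /qS; congr (graph _ _ _); apply: val_inj; rewrite /= behead_map.
- case=> /= s1 [_ ->] [s2 [_ ->]].
  case=> s3 st [s4 ex [s5 [/= /eqP/eqP e5 ->] [_ ->]]] /=.
  have yb : all (gtn b.+3) (b :: args).
    by rewrite /= (sub_all _ args_b) ?andbT//= => [|r /=]; lia.
  have vy u : (forall r, r < b -> u r = s r) ->
      values u [tuple of b :: args] = [tuple of u b :: values s args].
    move=> us; apply: val_inj => /=; congr (_ :: _).
    by apply/eq_in_map => r /(allP args_b); apply: us.
  (* Loop invariant: all candidates below the content of register [b] have been rejected, and
     register [b.+2] still holds the 0 used in the tests. *)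
  have [agr z3 h3] : [/\ forall r, r < b -> s3 r = s r, s3 b.+2 = 0 &
      forall i, i < s3 b -> exists z, graph f [tuple of i :: values s args] z.+1].
    elim: st => [|u w _ [agr z h] [u1 eu [u2 [/= /eqP/eqP neq ->] [_ ->]]]].
      split; first by move=> r rb; rewrite /set_reg !ltn_eqF//; lia.
        by rewrite /set_reg eqxx.
      by rewrite /set_reg ltn_eqF ?eqxx//; lia.
    have [fu agru] := IHf _ _ _ _ _ yb eu; rewrite /= /set_reg eqxx.
    split; first by move=> r rb; rewrite ltn_eqF// agru ?agr//; lia.
      by rewrite gtn_eqF ?agru//; lia.
    move=> i; rewrite agru; [|lia|lia]; rewrite ltnS leq_eqVlt.
    case/predU1P=> [->|]; last exact: h.
    move: fu neq; rewrite (agru b.+2) ?z; [|lia|lia]; rewrite vy//.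
    by case: (u1 b.+1) => // n fu _; exists n.
  have [fu agru] := IHf _ _ _ _ _ yb ex.
  split; last first.
    by move=> r rb ro; rewrite /set_reg (negPf ro) agru ?agr//; lia.
  rewrite /set_reg eqxx agru; [|lia|lia]; split=> //.
  by move: fu; rewrite vy// e5 agru ?z3//; lia.
Qed.

Lemma compile_complete k (f : recfun k) (args : k.-tuple nat) out b s y :
  all (gtn b) args -> graph f (values s args) y ->
  exists t, [/\ exec (compile f args out b) s t, t out = y & agree b out s t].
Proof.
(* Soundness and [graph_inj] determine the result of any execution, so only the existence of one
   remains. *)
move=> args_b fy; suff [t ex] : exists t, exec (compile f args out b) s t.
  have [fo agr] := compile_sound args_b ex.
  by exists t; split=> //; apply: graph_inj fo fy.
elim: k / f args out b s y args_b fy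
  => [k|| k i|k m f IHf g IHg|k f IHf g IHg|k f IHf] args out b s y args_b.
- by move=> _; eexists; split.
- by move=> _; eexists; eexists; split.
- by move=> _; eexists; split.
- move=> /= [w [gw fw]].
  have bm : all (gtn (b + m)) [tuple b + i | i < m].
    by apply/allP=> r /mapP[i _ ->] /=; rewrite ltn_add2l.
  have args_bm : all (gtn (b + m)) args.
    by apply: (sub_all _ args_b) => r /= rb; rewrite ltn_addr.
  suff: forall (l : seq 'I_m) s', (forall r, r < b -> s' r = s r) ->
      (forall i : 'I_m, i \notin l -> s' (b + i) = tnth w i) ->
      exists t, exec (foldr (fun i c => compile (g i) args (b + i) (b + m) ;; c)
        (compile f [tuple b + i | i < m] out (b + m)) l) s' t.
    by apply=> // i; rewrite mem_enum.
  elim=> [|i l IHl] s' agr ws /=.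
    apply: (IHf _ out _ _ y bm); congr (graph _ _ _): fw.
    by apply: eq_from_tnth => i; rewrite tnth_map tnth_mktuple ws.
  have vs : values s' args = values s args.
    by apply: val_inj; apply/eq_in_map => r /(allP args_b) /=; apply: agr.
  have [|t et] := IHg i _ (b + i) _ s' (tnth w i) args_bm; first by rewrite vs; apply: gw.
  have [gi agrt] := compile_sound args_bm et; rewrite vs in gi.
  have [r rb|j jl|u eu] := IHl t.
  + by rewrite agrt ?agr//; lia.
  + case: (eqVneq j i) => [->|ji]; first exact: graph_inj gi (gw i).
    by rewrite agrt ?ws ?inE ?negb_or ?ji ?eqn_add2l// ltn_add2l.
  + by exists u; exists t.
- move=> /= [sq [q0 qS _]].
  set x := [tuple of behead args].
  have [n_b xb] : thead args < b /\ all (gtn b) x.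
    by rewrite /x; case/tupleP: (args) args_b => a v /= /andP[].
  have x_b : all (gtn b.+2) x by apply: (sub_all _ xb) => r /=; lia.
  have vn : thead (values s args) = s (thead args) by rewrite /thead tnth_map.
  have fx : graph f (values s x) (sq 0).
    by congr (graph _ _ _): q0; apply: val_inj; rewrite /= behead_map.
  have [s1 e1] := IHf _ b _ _ _ x_b fx.
  have [f1 agr1] := compile_sound x_b e1.
  pose body := Act (Test false b.+1 (thead args)) ;;
    compile g [tuple of b.+1 :: b :: x] b b.+2 ;; Act (Inc b.+1).
  suff loop n : n <= s (thead args) -> exists s3,
      [/\ star (exec body) (set_reg s1 b.+1 0) s3, s3 b.+1 = n, s3 b = sq n
         & forall r, r < b -> s3 r = s r].
    have [s3 [e3 c3 _ agr]] := loop _ (leqnn _).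
    eexists; exists s1 => //; eexists; first by split.
    exists s3 => //; eexists; first by split; rewrite //= c3 agr ?eqxx.
    by split.
  elim: n => [_|n IHn lt_n].
    exists (set_reg s1 b.+1 0); rewrite /set_reg eqxx ltn_eqF//; split=> //.
    - exact: star_refl.
    - exact: graph_inj f1 fx.
    - by move=> r rb; rewrite ltn_eqF ?agr1//; lia.
  have [u [eu uc ub agr]] := IHn (ltnW lt_n).
  have cx : all (gtn b.+2) (b.+1 :: b :: x) by rewrite /= x_b; lia.
  have gn : graph g (values u [tuple of b.+1 :: b :: x]) (sq n.+1).
    have := qS n; rewrite vn => /(_ lt_n); congr (graph _ _ _).
    apply: val_inj => /=; rewrite uc ub behead_map; congr [:: _, _ & _].
    by apply/esym/eq_in_map => r /(allP xb) /=; apply: agr.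
  have [u2 e2] := IHg _ b _ _ _ cx gn.
  have [g2 agr2] := compile_sound cx e2.
  exists (set_reg u2 b.+1 (u2 b.+1).+1); split.
  + apply: star_snoc eu _; exists u.
      by split; rewrite //= uc agr// ltn_eqF.
    by exists u2.
  + by rewrite /set_reg eqxx agr2 ?uc//; lia.
  + by rewrite /set_reg ltn_eqF//; apply: graph_inj g2 gn.
  + by move=> r rb; rewrite /set_reg ltn_eqF ?agr2 ?agr//; lia.
- move=> /= [fy fS].
  have yb : all (gtn b.+3) [tuple of b :: args].
    by rewrite /= (sub_all _ args_b) ?andbT//= => [|r /=]; lia.
  have vy u : (forall r, r < b -> u r = s r) ->
      values u [tuple of b :: args] = [tuple of u b :: values s args].
    move=> us; apply: val_inj => /=; congr (_ :: _).
    by apply/eq_in_map => r /(allP args_b); apply: us.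
  set c := compile f [tuple of b :: args] b.+1 b.+3.
  pose body := c ;; Act (Test false b.+1 b.+2) ;; Act (Inc b).
  suff loop n : n <= y -> exists s3,
      [/\ star (exec body) (set_reg (set_reg s b 0) b.+2 0) s3,
          s3 b = n, s3 b.+2 = 0 & forall r, r < b -> s3 r = s r].
    have [s3 [e3 c3 z3 agr]] := loop _ (leqnn _).
    have fy3 : graph f (values s3 [tuple of b :: args]) 0 by rewrite vy// c3.
    have [s4 e4] := IHf _ b.+1 _ _ _ yb fy3.
    have [f4 agr4] := compile_sound yb e4.
    eexists; eexists; first by split.
    eexists; first by split.
    exists s3 => //; exists s4 => //; eexists; last by split.
    split=> //=; rewrite (graph_inj f4 fy3) agr4 ?z3//; lia.
  elim: n => [_|n IHn lt_n].
    exists (set_reg (set_reg s b 0) b.+2 0); rewrite /set_reg !eqxx ltn_eqF//; split=> //.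
    - exact: star_refl.
    - by move=> r rb; rewrite !ltn_eqF//; lia.
  have [u [eu uc uz agr]] := IHn (ltnW lt_n).
  have [z fz] := fS _ lt_n.
  have fz' : graph f (values u [tuple of b :: args]) z.+1 by rewrite vy// uc.
  have [u1 e1] := IHf _ b.+1 _ _ _ yb fz'.
  have [f1 agr1] := compile_sound yb e1.
  exists (set_reg u1 b (u1 b).+1); split.
  + apply: star_snoc eu _; exists u1 => //; exists u1 => //.
    split=> //=; rewrite (graph_inj f1 fz') agr1 ?uz//; lia.
  + by rewrite /set_reg eqxx agr1 ?uc//; lia.
  + by rewrite /set_reg gtn_eqF ?agr1//; lia.
  + by move=> r rb; rewrite /set_reg ltn_eqF ?agr1 ?agr//; lia.
Qed.

(** * Finite control *)

Record nfa := Nfa {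
  state : finType;
  ini : state;
  fin : state;
  edges : seq (state * act * state)
}.

Inductive path (A : nfa) (p : state A) (s : regs) : state A -> regs -> Prop :=
| path_refl : path p s p s
| path_snoc q t e : path p s q t -> List.In e (edges A) -> e.1.1 = q ->
    guard e.1.2 t -> path p s e.2 (update e.1.2 t).

Lemma path_trans A (p q r : state A) s t u :
  path p s q t -> path q t r u -> path p s r u.
Proof.
move=> pq; elim=> // q' t' e _ pq' eA eq' ge; exact: path_snoc pq' eA eq' ge.
Qed.

Lemma path_edge A (p q : state A) s a :
  List.In (p, a, q) (edges A) -> guard a s -> path p s q (update a s).
Proof. by move=> pq gs; apply: path_snoc (path_refl p s) pq _ gs. Qed.

Definition map_edge (S T : Type) (h : S -> T) (e : S * act * S) :=
  (h e.1.1, e.1.2, h e.2).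

Lemma path_map (A B : nfa) (h : state A -> state B) p q s t :
  (forall e, List.In e (edges A) -> List.In (map_edge h e) (edges B)) ->
  path p s q t -> path (h p) s (h q) t.
Proof.
move=> hAB; elim=> [|q' t' e _ pq eA eq ge]; first exact: path_refl.
exact: path_snoc pq (hAB _ eA) (congr1 h eq) ge.
Qed.

Definition nfa_act a : nfa := @Nfa bool false true [:: (false, a, true)].

Definition nfa_seq (A B : nfa) : nfa :=
  @Nfa (state A + state B)%type (inl (ini A)) (inr (fin B))
    ((inl (fin A), skip, inr (ini B)) ::
     map (map_edge inl) (edges A) ++ map (map_edge inr) (edges B)).

(** A fresh state serves as both ends, because a run of [A] may revisit [ini A] before it is
    complete. *)
Definition nfa_star (A : nfa) : nfa :=
  @Nfa (option (state A)) None None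
    [:: (None, skip, Some (ini A)), (Some (fin A), skip, None)
      & map (map_edge Some) (edges A)].

Fixpoint nfa_cmd (c : cmd) : nfa :=
  match c with
  | Act a => nfa_act a
  | Seq c d => nfa_seq (nfa_cmd c) (nfa_cmd d)
  | Star c => nfa_star (nfa_cmd c)
  end.

Definition run (A : nfa) s t := path (ini A) s (fin A) t.

Lemma run_seq A B s u : run (nfa_seq A B) s u <-> exists2 t, run A s t & run B t u.
Proof.
split=> [|[t st tu]].
  (* No edge leads back from the right copy, so a path ending there splits at its single crossing of
     the joining edge. *)
  suff h q t : path (ini (nfa_seq A B)) s q t ->
      match q with
      | inl q => path (ini A) s q t
      | inr q => exists2 t', run A s t' & path (ini B) t' q t
      end by apply: h.
  elim=> [|{}q {}t e _ IH /= eAB eq ge]; first exact: path_refl.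
  case: eAB eq IH ge => [<-|/List.in_app_iff[]/List.in_map_iff[e' [<- eA]]] /= <-.
  - by move=> st _; exists t; [exact: st | exact: path_refl].
  - by move=> IH ge; apply: path_snoc IH eA _ ge.
  - by move=> [t' st IH] ge; exists t' => //; apply: path_snoc IH eA _ ge.
have p1 : path (A := nfa_seq A B) (inl (ini A)) s (inl (fin A)) t.
  apply: path_map st => e eA; right; apply/List.in_app_iff; left.
  exact: List.in_map.
have p2 : path (A := nfa_seq A B) (inr (ini B)) t (inr (fin B)) u.
  apply: path_map tu => e eA; right; apply/List.in_app_iff; right.
  exact: List.in_map.
apply: path_trans p1 (path_trans _ p2); rewrite -[t in path _ _ _ t]/(update skip t).
by apply: path_edge; [left | rewrite /= eqxx].
Qed.

Lemma run_star A s u : run (nfa_star A) s u <-> star (run A) s u.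
Proof.
split=> [|].
  (* At [None] a whole number of rounds is complete; in the copy of [A] one more is in progress. *)
  suff h q t : path (ini (nfa_star A)) s q t ->
      match q with
      | None => star (run A) s t
      | Some q => exists2 t', star (run A) s t' & path (ini A) t' q t
      end by apply: h.
  elim=> [|{}q {}t e _ IH /= eA eq ge]; first exact: star_refl.
  case: eA eq IH ge => [<-|[<-|/List.in_map_iff[e' [<- eA]]]] /= <-.
  - by move=> st _; exists t; [exact: st | exact: path_refl].
  - by move=> [t' st IH] _; apply: star_snoc st IH.
  - by move=> [t' st IH] ge; exists t' => //; apply: path_snoc IH eA _ ge.
elim=> [|t {}u _ st tu]; first exact: path_refl.
have p1 : path (A := nfa_star A) (Some (ini A)) t (Some (fin A)) u.
  apply: path_map tu => e eA; right; right; exact: List.in_map.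
apply: path_trans st _; apply: (@path_trans (nfa_star A) _ (Some (ini A)) _ _ t).
  rewrite -[t in path _ _ _ t]/(update skip t).
  by apply: path_edge; [left | rewrite /= eqxx].
apply: path_trans p1 _; rewrite -[u in path _ _ _ u]/(update skip u).
by apply: path_edge; [right; left | rewrite /= eqxx].
Qed.

Lemma run_nfa_cmd c s t : run (nfa_cmd c) s t <-> exec c s t.
Proof.
have starE R R' : (forall s t, R s t -> R' s t) ->
    forall s t, star R s t -> star R' s t.
  move=> RR' {}s {}t; elim=> [|u v _ su uv]; first exact: star_refl.
  exact: star_snoc su (RR' _ _ uv).
elim: c s t => [a|c IHc d IHd|c IHc] s t /=.
- split=> [|[ge ->]]; last by apply: path_edge => //; left.
  suff h q u : path (ini (nfa_act a)) s q u ->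
      if q then guard a s /\ u = update a s else u = s by apply: h.
  elim=> [|{}q {}u e _ IH /= [<-|//] eq] //=.
  by rewrite -eq in IH; rewrite IH.
- rewrite run_seq; split=> -[u].
  + by move=> /IHc su /IHd ut; exists u.
  + by move=> /IHc su /IHd ut; exists u.
- by rewrite run_star; split; apply: starE => ? ? /IHc.
Qed.

(** * Simulation by a register automaton *)

Section Falling.
Local Open Scope ring_scope.

Definition shift_mul (p : {poly rat}) : {poly rat} := ('X - 1) * (p \Po ('X - 1)).

(* falling n = (X - 1) (X - 2) ... (X - n) *)
Definition falling (n : nat) : {poly rat} := iter n shift_mul 1.

Lemma horner_falling n x :
  (falling n.+1).[x] = (x - 1) * (falling n).[x - 1].
Proof. by rewrite /falling iterS /shift_mul hornerM horner_comp !hornerE. Qed.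

(** All roots of [falling n] are positive. *)
Lemma falling_opp_neq0 n m : (falling n).[- m%:R] != 0.
Proof.
elim: n m => [|n IHn] m; first by rewrite /falling /= hornerE oner_neq0.
rewrite horner_falling -opprD natr1 mulf_neq0//.
by rewrite oppr_eq0 pnatr_eq0.
Qed.

Lemma falling_eq0 n m : (0 < m <= n)%N -> (falling n).[m%:R] = 0.
Proof.
elim: n m => [|n IHn] [|m]// /= mn.
rewrite horner_falling -natr1 addrK.
by case: m mn => [|m] mn; [rewrite mul0r | rewrite IHn ?mulr0].
Qed.

Lemma falling_test n a b : (a <= n)%N -> (b <= n)%N ->
  ((falling n).[a%:R - b%:R] * (falling n).[b%:R - a%:R] != 0) = (a == b).
Proof.
wlog ab : a b / (a <= b)%N => [h an bn|an bn].
  case/orP: (leq_total a b) => ?; first exact: h.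
  by rewrite mulrC (eq_sym a); apply: h.
(* As [a <= b], the first factor is the value at a nonpositive integer and is nonzero, so the second
   one decides. *)
rewrite -opprB -natrB// mulf_eq0 (negPf (falling_opp_neq0 _ _)) /=.
case: (eqVneq a b) ab an => [->|neq] ab an.
  by have := falling_opp_neq0 n 0; rewrite subnn mulr0n oppr0 => ->.
by rewrite falling_eq0 ?eqxx// subn_gt0 ltn_neqAle neq ab /= leq_subLR; lia.
Qed.

End Falling.

Definition act_regs (a : act) : seq nat :=
  match a with
  | Test _ i j => [:: i; j]
  | Inc i => [:: i]
  | Reset i => [:: i]
  | Copy i j => [:: i; j]
  end.

Section Terms.
Local Open Scope ring_scope.
Variable V : Type.

Definition succ_term (t : term V) := TAdd t (TConst V 1).

Definition sub_term (t u : term V) := TAdd t (TMul (TConst V (-1)) u).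

Definition shift_term (t : term V) :=
  TMul (TConst V ('X - 1)) (TComp t (TConst V ('X - 1))).

(** A numeral is an iterated successor and not a single constant, so that its code is obtained by
    iterating one computable function on codes. *)
Definition nat_term (n : nat) := iter n succ_term (TConst V 0).

(** The value is [falling (sumn l)], where the sum bounds all entries of [l]. The nested iterations
    make the code computable from the entries. *)
Definition falling_term (l : seq nat) :=
  foldr (fun n => iter n shift_term) (TConst V 1) l.

Definition update_term (x : nat -> V) (a : act) (j : nat) : term V :=
  match a with
  | Test _ _ _ => TVar (x j)
  | Inc i => if j == i then succ_term (TVar (x j)) else TVar (x j)
  | Reset i => if j == i then TConst V 0 else TVar (x j)
  | Copy i k => TVar (x (if j == i then k else j))
  end.

(* The variable q stands for falling n.  Its value at the difference of two
   distinct registers bounded by n vanishes for one sign of the difference. *)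
Definition guard_term (q : V) (x : nat -> V) (a : act) : term V :=
  match a with
  | Test true i j =>
      TMul (TComp (TVar q) (sub_term (TVar (x i)) (TVar (x j))))
           (TComp (TVar q) (sub_term (TVar (x j)) (TVar (x i))))
  | Test false i j => sub_term (TVar (x i)) (TVar (x j))
  | _ => TConst V 1
  end.

Variables (e : V -> {poly rat}).

Lemma eval_nat_term n : eval e (nat_term n) = n%:R%:P.
Proof.
by rewrite /nat_term; elim: n => //= n ->; rewrite -natr1 polyCD.
Qed.

Lemma eval_falling_term l : eval e (falling_term l) = falling (sumn l).
Proof.
elim: l => //= n l IHl; rewrite /falling iterD -/(falling _) -{}IHl.
by elim: n => //= n ->.
Qed.

Variables (N : nat) (x : nat -> V) (q : V) (s : regs) (n : nat).
Hypotheses (xP : forall k, (k < N)%N -> e (x k) = (s k)%:R%:P)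
           (sP : forall k, (k < N)%N -> (s k <= n)%N)
           (qP : e q = falling n).

Lemma eval_update_term a j : all (gtn N) (act_regs a) -> (j < N)%N ->
  eval e (update_term x a j) = (update a s j)%:R%:P.
Proof.
move=> aN jN; case: a aN => [b i k|i|i|i k] /= aN; rewrite /set_reg.
- by rewrite xP.
- case: eqP => [<-|_] /=; rewrite xP//.
  by rewrite -[in RHS]natr1 polyCD.
- by case: eqP => //= _; rewrite xP.
- by case/and3P: aN => _ kN _; rewrite xP; case: eqP.
Qed.

(** The bound grows at every action, increment or not, because [shift_term] is applied at every
    edge. *)
Lemma update_leq a j : all (gtn N) (act_regs a) -> (j < N)%N ->
  (update a s j <= n.+1)%N.
Proof.
move=> aN jN; have sn k : (k < N)%N -> (s k <= n.+1)%N by move/sP/leqW.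
case: a aN => [b i k|i|i|i k] /= aN; rewrite ?sn// /set_reg;
  case: eqP => _; rewrite ?sn//.
- by rewrite ltnS; case/andP: aN => iN _; apply: sP.
- by case/and3P: aN.
Qed.

Lemma eval_guard_term a : all (gtn N) (act_regs a) ->
  (eval e (guard_term q x a) != 0) = guard a s.
Proof.
case: a => [[] i j|i|i|i j] /=; rewrite ?oner_neq0// => /and3P[iN jN _].
  rewrite qP !xP// !mulN1r -!polyCB.
  (* Composition with a constant polynomial is evaluation. *)
  rewrite !comp_polyCr -polyCM polyC_eq0 falling_test ?sP//.
  by case: eqP.
rewrite !xP// mulN1r -polyCB polyC_eq0 subr_eq0 eqr_nat.
by case: eqP.
Qed.

End Terms.

Lemma In_tnth (T : Type) (l : seq T) e :
  List.In e l <-> exists i, e = tnth (in_tuple l) i.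
Proof.
split=> [|[i ->]].
  elim: l => //= x l IHl [<-|/IHl[i ->]]; first by exists ord0.
  by exists (lift ord0 i); rewrite !(tnth_nth x).
case: l i => [[]//|x l] i; rewrite (tnth_nth x) /=.
move: (nat_of_ord i) (ltn_ord i) => {i} j.
elim: l x j => [|y l IHl] x [|j] //= jl; try by left.
by right; rewrite (set_nth_default y) //; apply: (IHl y).
Qed.

Lemma In_mem (T : eqType) (x : T) (l : seq T) : x \in l <-> List.In x l.
Proof.
elim: l => //= y l <-; rewrite inE; split=> [/predU1P[->|]|[->|->]]; try by [left|right].
  by rewrite eqxx.
by rewrite orbT.
Qed.

(** * The simulating automata and their runs *)

Section Simulation.

Variables (S' : signature) (A : nfa) (N : nat).
Local Notation S := (0 :: S').
(** An injective [letter] makes the automaton with one initial rule deterministic, and a constant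
    one allows a one-letter alphabet. *)
Variables (letter : 'I_(size (edges A)) -> symbol S)
  (letterP : forall i, 0 < rank (letter i)).
Hypothesis edgesP : forall e, List.In e (edges A) -> all (gtn N) (act_regs e.1.2).
Variable inputs : seq nat.

Local Notation nregs := N.+2.
Local Notation nstates := #|state A|.

(* Register 0 holds the product of all guards met so far, register 1 the
   polynomial falling n after at most n increments, and register k + 2
   simulates register k of the program. *)
Definition cell (k : nat) : 'I_nregs := inord k.+2.
Definition flag : 'I_nregs := ord0.
Definition fall : 'I_nregs := inord 1.

Definition edge_update (V : Type) (x : 'I_nregs -> V) (a : act) (j : 'I_nregs) :=
  match nat_of_ord j with
  | 0 => TMul (TVar (x flag)) (guard_term (x fall) (x \o cell) a)
  | 1 => shift_term (TVar (x fall))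
  | k.+2 => update_term (x \o cell) a k
  end.

Definition edge_rule (a : symbol S) (ha : 0 < rank a) (e : state A * act * state A) :
    rule S nregs nstates :=
  @Rule S nregs nstates a [ffun=> enum_rank e.1.1] (enum_rank e.2)
    [ffun j => edge_update (fun j => (j, Ordinal ha)) e.1.2 j].

Definition edge_rules : seq (rule S nregs nstates) :=
  [seq edge_rule (letterP i) (tnth (in_tuple (edges A)) i)
     | i <- enum 'I_(size (edges A))].

Definition init_terms (V : Type) (b : bool) : seq (term V) :=
  [:: TConst V (b%:R)%R, falling_term V inputs & map (nat_term V) inputs]
    ++ nseq (N - size inputs) (TConst V 0%R).

Definition init_rule (b : bool) : rule S nregs nstates :=
  @Rule S nregs nstates (@ord0 (size S')) [ffun=> enum_rank (ini A)] (enum_rank (ini A))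
    [ffun j => nth (TConst _ 0%R) (init_terms _ b) (nat_of_ord j)].

Definition final_flag : {ffun 'I_nstates -> option (term 'I_nregs)} :=
  [ffun q => if q == enum_rank (fin A) then Some (TVar flag) else None].

Definition aut (bs : seq bool) : automaton S :=
  @Automaton S nregs nstates (map init_rule bs ++ edge_rules)
    final_flag.

(** The simulation invariant. The flag is left out: the other registers are updated faithfully even
    after a failed guard. *)
Definition matches (v : {ffun 'I_nregs -> {poly rat}}) (s : regs) (n : nat) : Prop :=
  [/\ forall k, k < N -> v (cell k) = (s k)%:R%:P%R,
      forall k, k < N -> s k <= n & v fall = falling n].

Lemma val_cell k : k < N -> cell k = k.+2 :> nat.
Proof. by move=> kN; rewrite inordK. Qed.

Lemma val_fall : fall = 1 :> nat.
Proof. by rewrite inordK. Qed.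

Lemma init_matches b (v : {ffun 'I_nregs -> {poly rat}}) (V : Type)
    (e : V -> {poly rat}) :
  (forall j : 'I_nregs, v j = eval e (nth (TConst _ 0%R) (init_terms _ b) j)) ->
  v flag = (b%:R)%R /\ matches v (nth 0 inputs) (sumn inputs).
Proof.
move=> vE; split; first by rewrite vE.
split=> [k kN|k kN|]; last by rewrite vE val_fall /= eval_falling_term.
- rewrite vE val_cell//= nth_cat size_map; case: ltnP => [ki|ki].
    by rewrite (nth_map 0)// eval_nat_term.
  (* Beyond the inputs, the default value of [nth] is the 0 stored in the register. *)
  by rewrite nth_nseq if_same [nth 0 _ _]nth_default.
- case: (ltnP k (size inputs)) => [ki|ki]; last by rewrite nth_default.
  elim: (inputs) k ki {kN} => //= x l IHl [|k] ki; first exact: leq_addr.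
  by rewrite (leq_trans (IHl k ki))// leq_addl.
Qed.

(** Q[x] is an integral domain, so the flag vanishes from the first failed guard on, and only then
    if it started nonzero. *)
Lemma edge_matches (v w : {ffun 'I_nregs -> {poly rat}}) s n a (V : Type)
    (x : 'I_nregs -> V) (e : V -> {poly rat}) :
  all (gtn N) (act_regs a) -> matches v s n ->
  (forall j, e (x j) = v j) -> (forall j, w j = eval e (edge_update x a j)) ->
  matches w (update a s) n.+1 /\ (w flag != 0 = (v flag != 0) && guard a s)%R.
Proof.
move=> aN [vs sn vf] ex wE.
have xs k : k < N -> e ((x \o cell) k) = (s k)%:R%:P%R by move=> kN; rewrite /= ex vs.
split.
  split=> [k kN|k kN|].
  - by rewrite wE /edge_update val_cell//; apply: (eval_update_term (N := N)).
  - exact: (update_leq (N := N)).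
  - by rewrite wE /edge_update val_fall /= ex vf.
rewrite wE /edge_update /= ex mulf_eq0 negb_or; congr (_ && _).
by apply: (eval_guard_term (N := N) (n := n)); rewrite // ex.
Qed.

Lemma In_rules bs r : List.In r (rules (aut bs)) <->
  (exists2 b, b \in bs & r = init_rule b) \/
  (exists2 i, true & r = edge_rule (letterP i) (tnth (in_tuple (edges A)) i)).
Proof.
rewrite List.in_app_iff; split=> [[]/List.in_map_iff[b [<- /In_mem bbs]]|].
- by left; exists b.
- by right; exists b.
case=> [[b bbs ->]|[i _ ->]]; [left|right]; apply/List.in_map_iff; eexists.
  by split; [|apply/In_mem; apply: bbs].
by split; [|apply/In_mem; apply: mem_enum].
Qed.

(** Runs may take edges whose guards fail, or start with the flag 0; in both cases the flag stays 0.
    Any other run follows an actual path of [A]. *)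
Lemma reach_sound bs t q v : reach (M := aut bs) t q v ->
  v flag = 0%R \/ true \in bs /\
  exists s n, path (ini A) (nth 0 inputs) (enum_val q) s /\ matches v s n.
Proof.
elim=> r ts w /In_rules rE _ IH.
set v' := finfun _.
have vE j : v' j = eval (fun x => w x.2 x.1) (rupd r j) by rewrite ffunE.
case: rE => [[b bbs er]|[i _ er]]; subst r.
  have [v'0 mv] := @init_matches b v' _ (fun x => w x.2 x.1)
    (fun j => etrans (vE j) (congr1 _ (ffunE _ _))).
  case: b bbs ts w IH @v' vE v'0 mv => bbs ts w IH v' vE v'0 mv; last by left.
  right; split=> //; exists (nth 0 inputs), (sumn inputs); split=> //.
  by rewrite /= enum_rankK; apply: path_refl.
set e := tnth _ i in w IH v' vE *.
pose i0 := Ordinal (letterP i).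
have eA : List.In e (edges A) by apply/In_tnth; exists i.
have := IH i0; rewrite /= ffunE => -[v0|[bT [s [n [ps mv]]]]].
  by left; rewrite vE ffunE /= v0 mul0r.
have [mv' fl] := @edge_matches (w i0) v' s n e.1.2 _ (fun j => (j, i0))
  (fun x => w x.2 x.1) (edgesP eA) mv (fun=> erefl)
  (fun j => etrans (vE j) (congr1 _ (ffunE _ _))).
case: (eqVneq (v' flag) 0%R) => [|nz]; first by left.
right; split=> //; exists (update e.1.2 s), n.+1; split=> //=.
rewrite enum_rankK; apply: path_snoc ps eA _ _; first by rewrite enum_rankK.
by move: fl; rewrite nz => /esym/andP[].
Qed.

Lemma reach_complete q s : path (ini A) (nth 0 inputs) q s ->
  exists t v n, [/\ reach (M := aut [:: true]) t (enum_rank q) v, matches v s n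
                  & v flag != 0%R].
Proof.
elim=> [|{}q {}s e _ [t [v [n [tq mv nz]]]] eA eq ge].
  have ri : List.In (init_rule true) (rules (aut [:: true])) by left.
  have noI : 'I_(rank (rsym (init_rule true))) -> False by case.
  pose ts : {ffun 'I_(rank (rsym (init_rule true))) -> tree S} :=
    [ffun i => False_rect _ (noI i)].
  pose w i : {ffun 'I_nregs -> {poly rat}} := False_rect _ (noI i).
  have := @Reach S (aut [:: true]) _ ts w ri (fun i => False_ind _ (noI i)).
  set v := finfun _ => re.
  have [v1 mv] := @init_matches true v _ (fun x => w x.2 x.1)
    (fun j => etrans (ffunE _ _) (congr1 (eval _) (ffunE _ _))).
  exists (Node ts), v, (sumn inputs); split=> //.
  by rewrite v1 oner_neq0.
have /In_tnth[i ei] := eA.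
have ri : List.In (edge_rule (letterP i) e) (rules (aut [:: true])).
  by apply/In_rules; right; exists i; rewrite // ei.
pose ts : {ffun 'I_(rank (letter i)) -> tree S} := [ffun=> t].
have := @Reach S (aut [:: true]) (edge_rule (letterP i) e) ts (fun=> v) ri.
set v' := finfun _ => re.
have [mv' fl] := @edge_matches v v' s n e.1.2 _ (fun j => (j, Ordinal (letterP i)))
  (fun x => v x.1) (edgesP eA) mv (fun=> erefl)
  (fun j => etrans (ffunE _ _) (congr1 (eval _) (ffunE _ _))).
exists (Node ts), v', n.+1; split=> //.
  by apply: re => j; rewrite !ffunE eq.
by rewrite fl nz ge.
Qed.

(* The automata differ only in the values of the flag written by their initial
   rules, so a run of one can be replayed by the other on the same tree. *)
Lemma reach_restart bs bs0 b t (q : 'I_nstates) v : b \in bs ->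
  reach (M := aut bs0) t q v -> exists v', reach (M := aut bs) t q v'.
Proof.
move=> bbs; elim=> r ts w /In_rules rE _ IH.
have [w' w'P] := fin_all_exists IH.
case: rE => [[b' _ er]|[i _ er]]; subst r.
  have ri : List.In (init_rule b) (rules (aut bs)) by apply/In_rules; left; exists b.
  by eexists; apply: (@Reach S (aut bs) (init_rule b) ts w').
eexists; apply: (@Reach S (aut bs) _ ts w') => //.
by apply/In_rules; right; exists i.
Qed.

Lemma reach_subset bs bs0 t (q : 'I_nstates) (v : {ffun 'I_nregs -> {poly rat}}) :
  {subset bs0 <= bs} ->
  reach (M := aut bs0) t q v -> reach (M := aut bs) t q v.
Proof.
move=> sub; elim=> r ts w /In_rules rE _ IH.
apply: (@Reach S (aut bs)) => //; apply/In_rules.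
by case: rE => [[b /sub]|]; [left; exists b | right].
Qed.

Lemma relates_aut bs t p : relates (aut bs) t p <->
  exists v, reach (M := aut bs) t (enum_rank (fin A)) v /\ p = v flag.
Proof.
split=> [[q [v [f [tq]]]]|[v [tv ->]]].
  by rewrite /= ffunE; case: eqP => // qE [<-] ->; exists v; rewrite -qE.
by exists (enum_rank (fin A)), v, (TVar flag); split=> //; rewrite /= ffunE eqxx.
Qed.

Let halts := exists s, run A (nth 0 inputs) s.

Lemma relates_eq0 bs t p : ~ halts -> relates (aut bs) t p -> p = 0%R.
Proof.
move=> nh /relates_aut[v [/reach_sound[->//|[_ [s [n [ps _]]]]] _]].
by case: nh; exists s; rewrite enum_rankK in ps.
Qed.

(** Without a halting computation both runs output 0, so replaying a run preserves its value. *)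
Lemma relates_restart bs bs0 b t p : ~ halts -> b \in bs ->
  relates (aut bs0) t p -> relates (aut bs) t p.
Proof.
move=> nh bbs rt; have p0 := relates_eq0 nh rt.
have /relates_aut[v [/(reach_restart bbs)[v' tv'] _]] := rt.
have rt' : relates (aut bs) t (v' flag) by apply/relates_aut; exists v'.
by rewrite p0 -(relates_eq0 nh rt').
Qed.

(** The tree comes from the halting computation. On it, one automaton outputs a nonzero flag, while
    the other can replay the run and outputs only 0. *)
Lemma halts_relates : halts -> exists t p,
  [/\ p != 0%R, relates (aut [:: true]) t p, relates (aut [:: false]) t 0%R
    & ~ relates (aut [:: false]) t p].
Proof.
case=> s /reach_complete[t [v [n [tv _ nz]]]].
have zero p : relates (aut [:: false]) t p -> p = 0%R.
  by case/relates_aut=> v0 [/reach_sound[->|[]]].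
have [v' tv'] := reach_restart (mem_head false [::]) tv.
have rt' : relates (aut [:: false]) t (v' flag) by apply/relates_aut; exists v'.
exists t, (v flag); split=> //; first by apply/relates_aut; exists v.
  by rewrite -(zero _ rt').
by move/zero=> v0; rewrite v0 eqxx in nz.
Qed.

Lemma relates_subset bs bs0 t p : {subset bs0 <= bs} ->
  relates (aut bs0) t p -> relates (aut bs) t p.
Proof.
move=> sub /relates_aut[v [tv pv]]; apply/relates_aut; exists v; split=> //.
exact: reach_subset tv.
Qed.

Lemma equivalent_halts :
  (halts -> ~ equivalent (aut [:: true]) (aut [:: false])) /\
  (~ halts -> equivalent (aut [:: true]) (aut [:: false])).
Proof.
split=> [/halts_relates[t [p [_ tp _ ntp]]] /(_ t p)[/(_ tp)]//|nh t p].
by split; apply: relates_restart => //; apply: mem_head.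
Qed.

Lemma functional_halts :
  (halts -> ~ functional (aut [:: true; false])) /\
  (~ halts -> functional (aut [:: true; false])).
Proof.
split=> [/halts_relates[t [p [nz tp t0 _]]] func|nh t p1 p2]; last first.
  by move=> /(relates_eq0 nh)-> /(relates_eq0 nh)->.
move/eqP: nz; apply; apply: (func t).
  by apply: relates_subset tp => b; rewrite !inE => ->.
by apply: relates_subset t0 => b; rewrite !inE orbC => ->.
Qed.

(** Distinct edges read distinct letters of positive rank, and the only initial rule reads a symbol
    of rank 0. *)
Lemma deterministic_aut b : injective letter -> deterministic (aut [:: b]).
Proof.
move=> inj r1 r2 /In_rules r1E /In_rules r2E /(congr1 (@projT1 _ _)) /=.
case: r1E r2E => [[b1 + ->]|[i _ ->]] [[b2 + ->]|[j _ ->]] /=.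
- by rewrite !inE => /eqP-> /eqP->.
- by move=> _ e; exfalso; have := letterP j; rewrite -e.
- by move=> _ e; exfalso; have := letterP i; rewrite e.
- by move=> /inj ->.
Qed.

End Simulation.

(** * Codes of the automata, and diagonalization *)

Lemma edges_bounded (A : nfa) n : exists2 N, n <= N &
  forall e, List.In e (edges A) -> all (gtn N) (act_regs e.1.2).
Proof.
elim: (edges A) => [|e l [N nN lN]]; first by exists n.
exists (foldr maxn N [seq r.+1 | r <- act_regs e.1.2]).
  by elim: act_regs => //= r rs; rewrite leq_max orbC => ->.
have mono r : r < N -> r < foldr maxn N [seq r.+1 | r <- act_regs e.1.2].
  by move=> rN; elim: act_regs => //= q rs; rewrite leq_max orbC => ->.
move=> e' [<-|/lN lt]; last by apply: sub_all lt.
elim: act_regs => //= r rs IHrs; rewrite leq_max leqnn /=.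
by apply: sub_all IHrs => q /= lt; rewrite leq_max orbC lt.
Qed.

Lemma nfa_of_recfun k (h : recfun k) : exists A : nfa, forall v : k.-tuple nat,
  (exists s, run A (nth 0 v) s) <-> graph h v 1.
Proof.
pose args : k.-tuple nat := [tuple i : nat | i < k].
have args_k : all (gtn k.+1) args.
  by apply/allP=> r /mapP[i _ ->] /=; rewrite ltnS ltnW.
(* The result is left in register [k] and compared with a 1 built in register [k.+1], so that a
   result other than 1 also prevents halting. *)
exists (nfa_cmd (compile h args k k.+1 ;; Act (Reset k.+1) ;; Act (Inc k.+1) ;;
                 Act (Test true k k.+1))) => v.
have vv : values (nth 0 v) args = v.
  by apply: eq_from_tnth => i; rewrite tnth_map tnth_mktuple (tnth_nth 0).
split=> [[s /run_nfa_cmd[t ht [_ [_ ->]]]]|h1].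
  case=> _ [_ ->] [/= + _]; rewrite /set_reg !eqxx (ltn_eqF (ltnSn k)) => /eqP/eqP t1.
  by have [] := compile_sound args_k ht; rewrite vv t1.
rewrite -vv in h1; have [t [ht t1 _]] := compile_complete k args_k h1.
eexists; apply/run_nfa_cmd; exists t => //; eexists; first by split.
eexists; first by split.
by split; rewrite //= /set_reg !eqxx (ltn_eqF (ltnSn k)) t1.
Qed.

Lemma nfa_of_reduction k (f : recfun 1) (C : k.-tuple nat -> nat) : computable C ->
  exists A : nfa, forall v : k.-tuple nat,
    (exists s, run A (nth 0 v) s) <-> graph f [tuple C v] 1.
Proof.
case=> r rP; have [A AP] := nfa_of_recfun (RComp f (fun _ : 'I_1 => r)).
exists A => v; rewrite AP /=; split=> [[w [wP]]|fC].
  suff -> : w = [tuple C v] by [].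
  apply: eq_from_tnth => i; rewrite [i]ord1; exact: graph_inj (wP ord0) (rP v).
by exists [tuple C v]; split=> // i; rewrite ord1; apply: rP.
Qed.

(** * Codes of terms, rules and automata as computable functions *)

Definition const_code (p : {poly rat}) := code_seq [:: 1; code_poly p].

Definition succ_code (n : nat) := code_seq [:: 2; n; const_code 1%R].

Definition shift_code (n : nat) :=
  code_seq [:: 3; const_code ('X - 1)%R; code_seq [:: 4; n; const_code ('X - 1)%R]].

Lemma code_nat_term V (c : V -> nat) n :
  code_term c (nat_term V n) = iter n succ_code (const_code 0%R).
Proof. by elim: n => // n; apply: (congr1 succ_code). Qed.

Lemma code_falling_term V (c : V -> nat) l : code_term c (falling_term V l) =
  foldr (fun n => iter n shift_code) (const_code 1%R) l.
Proof.
elim: l => // n l IHl.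
transitivity (iter n shift_code (code_term c (falling_term V l))).
  by elim: n => // n; apply: (congr1 shift_code).
by rewrite IHl.
Qed.

(* The components of v are the numbers of registers and states, the initial
   state, and the codes of the edge rules, of the final function, of the initial
   contents of the registers which do not hold an input, and of the signature. *)
Definition init_rule_code (b : bool) (v : 7.-tuple nat) : nat :=
  (* The first 0 is the symbol, the second the code of the empty list of source states. *)
  code_seq [:: 0; 0; tnth v (inord 2);
    npair (const_code (b%:R)%R)
      (npair (foldr (fun i => iter (tnth v i) shift_code) (const_code 1%R) (enum 'I_7))
        (foldr (fun i => npair (iter (tnth v i) succ_code (const_code 0%R)))
          (tnth v (inord 5)) (enum 'I_7)))].

(** Only the initial rules involve the inputs and have to be rebuilt; the code of the list of edge
    rules is a parameter, used as the tail. *)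
Definition aut_code (bs : seq bool) (v : 7.-tuple nat) : nat :=
  code_seq [:: tnth v (inord 0); tnth v (inord 1);
    foldr (fun b => npair (init_rule_code b v)) (tnth v (inord 3)) bs;
    tnth v (inord 4)].

Definition equivalence_code (v : 7.-tuple nat) : nat :=
  code_seq [:: tnth v (inord 6); aut_code [:: true] v; aut_code [:: false] v].

Definition functionality_code (v : 7.-tuple nat) : nat :=
  code_seq [:: tnth v (inord 6); aut_code [:: true; false] v].

Lemma computable_code_cons k (F : k.-tuple nat -> nat) (l : k.-tuple nat -> seq nat) :
  computable F -> computable (fun v => code_seq (l v)) ->
  computable (fun v => code_seq (F v :: l v)).
Proof. exact: computable_npair. Qed.

Lemma computable1_succ_code : computable1 succ_code.
Proof.
do ![exact: computable_const | apply: computable_code_cons]; exact: computable_proj.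
Qed.

Lemma computable1_shift_code : computable1 shift_code.
Proof.
do ![exact: computable_const | apply: computable_code_cons]; exact: computable_proj.
Qed.

Lemma computable_init_rule_code b : computable (init_rule_code b).
Proof.
do ![exact: computable_const | exact: computable_proj | apply: computable_code_cons].
do ![exact: computable_const | apply: computable_npair].
  apply: computable_foldr => [i C cC|]; last exact: computable_const.
  exact: (computable_iter computable1_shift_code (computable_proj i) cC).
apply: computable_foldr => [i C cC|]; last exact: computable_proj.
apply: computable_npair cC.
exact: (computable_iter computable1_succ_code (computable_proj i) (computable_const _ _)).
Qed.

Lemma computable_aut_code bs : computable (aut_code bs).
Proof.
do ![exact: computable_const | exact: computable_proj | apply: computable_code_cons].
apply: computable_foldr => [b C|]; last exact: computable_proj.
exact/computable_npair/computable_init_rule_code.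
Qed.

Lemma computable_equivalence_code : computable equivalence_code.
Proof.
do ![exact: computable_const | exact: computable_proj | exact: computable_aut_code
    | apply: computable_code_cons].
Qed.

Lemma computable_functionality_code : computable functionality_code.
Proof.
do ![exact: computable_const | exact: computable_proj | exact: computable_aut_code
    | apply: computable_code_cons].
Qed.

Lemma code_seq_cat s t : code_seq (s ++ t) = foldr npair (code_seq t) s.
Proof. exact: foldr_cat. Qed.

Lemma foldr_tnth k (T R : Type) (F : T -> R -> R) z (v : k.-tuple T) :
  foldr F z v = foldr (fun i => F (tnth v i)) z (enum 'I_k).
Proof. by rewrite -[in LHS](map_tnth_enum v) foldr_map. Qed.

Section InstanceCode.

Variables (S' : signature) (A : nfa) (N : nat).
Variables (letter : 'I_(size (edges A)) -> symbol (0 :: S'))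
  (letterP : forall i, 0 < rank (letter i)).

(** None of these numbers depends on the inputs of the program, so they can themselves be taken as
    inputs without circularity. [N - 7] counts the registers left after the seven inputs. *)
Definition parameters : 7.-tuple nat :=
  [tuple N.+2; #|state A|; enum_rank (ini A) : nat;
    code_seq (map (@code_rule _ _ _) (edge_rules N letterP));
    code_fun (@code_final N.+2) (final_flag A N);
    code_seq (nseq (N - 7) (const_code 0%R));
    code_seq (0 :: S')].

Lemma code_init_rule b : 7 <= N ->
  code_rule (init_rule S' A N parameters b) = init_rule_code b parameters.
Proof.
move=> N7; rewrite /init_rule_code /code_rule.
have -> : code_fun (@nat_of_ord _) (rsrc (init_rule S' A N parameters b)) = 0.
  by rewrite /code_fun (size0nil (size_enum_ord 0)).
congr (code_seq [:: _; _; _; _]); first by rewrite (tnth_nth 0) inordK.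
set c := @code_upd_var _ _; pose L := init_terms N parameters ('I_N.+2 * 'I_0) b.
have sL : size L = N.+2 by rewrite size_cat /= size_nseq addSn addSn subnKC.
transitivity (code_seq (map (code_term c) L)).
  rewrite /code_fun; congr code_seq.
  rewrite -[in RHS](mkseq_nth (TConst _ 0%R) L) sL /mkseq -val_enum_ord -!map_comp.
  by apply: eq_map => j /=; rewrite ffunE.
transitivity (npair (const_code (b%:R)%R) (npair (code_term c (falling_term _ parameters))
    (foldr npair (code_seq (nseq (N - 7) (const_code 0%R)))
      (map (code_term c \o nat_term _) parameters)))).
  by rewrite map_cat code_seq_cat map_nseq map_comp.
rewrite code_falling_term foldr_tnth (eq_map (code_nat_term c)) foldr_map foldr_tnth.
by rewrite [tnth _ (inord 5)](tnth_nth 0) inordK.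
Qed.

Lemma code_aut_parameters bs : 7 <= N ->
  code_automaton (aut N letterP parameters bs) = aut_code bs parameters.
Proof.
move=> N7; rewrite /aut_code !(tnth_nth 0) !inordK//.
congr (code_seq [:: _; _; _; _]).
rewrite [rules _]/= map_cat code_seq_cat.
by elim: bs => // b bs IHbs; rewrite [LHS]/= IHbs code_init_rule.
Qed.

End InstanceCode.

(* If H holds, then P fails and f answers both 0 and 1 on c.  Hence H fails, so P
   holds and f answers 1 on c, which implies H. *)
Lemma diagonal (f : recfun 1) c (H P : Prop) :
  H <-> graph f [tuple c] 1 -> (H -> ~ P) -> (~ H -> P) ->
  (P -> graph f [tuple c] 1) -> (~ P -> graph f [tuple c] 0) -> False.
Proof.
move=> Hf HP nHP P1 P0.
have nH : ~ H.
  by move=> h; have := graph_inj (P0 (HP h)) (proj1 Hf h).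
exact/nH/Hf/P1/nHP.
Qed.

(** * The two undecidability results *)

Lemma equivalence_undecidable : ~ equivalence_decidable monadic.
Proof.
case=> f fP.
have [A AP] := nfa_of_reduction f computable_equivalence_code.
have [N N7 NP] := edges_bounded A 7.
set n := size (edges A); pose S' := nseq n 1.
(* One letter per edge, shifted past the symbol of rank 0. *)
pose letter (i : 'I_n) : symbol (0 :: S') :=
  lift ord0 (cast_ord (esym (size_nseq n 1)) i).
have letterP i : 0 < rank (letter i).
  by rewrite /rank /= nth_nseq ltn_ord.
have letter_inj : injective letter by move=> i j /lift_inj/cast_ord_inj.
pose v := parameters N letterP.
pose M b := aut N letterP v [:: b].
pose I : pair_instance := existT _ (0 :: S') (M true, M false).
have [HP nHP] := equivalent_halts letterP NP v.
(* The program runs on the parameters of its own instance, whose code is thus the number on which it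
   queries [f]. *)
have eI : code_pair I = equivalence_code v.
  rewrite /code_pair /equivalence_code !code_aut_parameters//.
  by rewrite (tnth_nth 0) inordK.
have [|P1 P0] := fP I; last by rewrite eI in P1 P0; apply: (diagonal (AP v) HP nHP P1 P0).
split; last by split; apply: deterministic_aut.
rewrite /monadic /= count_nseq addn0 /=; apply/allP=> k /nseqP[->] //.
Qed.

Lemma functionality_undecidable : ~ functionality_decidable one_letter.
Proof.
case=> f fP.
have [A AP] := nfa_of_reduction f computable_functionality_code.
have [N N7 NP] := edges_bounded A 7.
(* All edges share the unary letter; the choice between them is left to nondeterminism. *)
pose letter (i : 'I_(size (edges A))) : symbol [:: 0; 1] := lift ord0 (ord0 : 'I_1).
have letterP i : 0 < rank (letter i) by [].
pose v := parameters N letterP.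
pose I : aut_instance := existT _ [:: 0; 1] (aut N letterP v [:: true; false]).
have [HP nHP] := functional_halts letterP NP v.
have eI : code_aut I = functionality_code v.
  rewrite /code_aut /functionality_code code_aut_parameters//.
  by rewrite (tnth_nth 0) inordK.
have [//|P1 P0] := fP I; rewrite eI in P1 P0.
exact: (diagonal (AP v) HP nHP P1 P0).
Qed.

Theorem theorem20 :
  (~ equivalence_decidable xpredT /\ ~ equivalence_decidable monadic) /\
  (~ functionality_decidable xpredT /\ ~ functionality_decidable one_letter).
Proof.
split; split.
(* A decider for all signatures also decides the restricted class of instances. *)
- case=> f fP; apply: equivalence_undecidable; exists f => I [_ D].
  exact: fP.
- exact: equivalence_undecidable.
- case=> f fP; apply: functionality_undecidable; exists f => I _.
  exact: fP.
- exact: functionality_undecidable.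
Qed.
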